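(* Let $K$ be a field of characteristic zero, $n\geq 1$, and $k=(k_1,\ldots,k_n)\in K^n$. Let $A_n^k$ be the $n$th hom-associative Weyl algebra over $K$. Then: (i) $K$ embeds as a subfield into $A_n^k$. (ii) $1_{A_n}$ is a unique weak identity element of $A_n^k$. (iii) $A_n^k$ contains no zero divisors. (iv) $A_n^k$ is power-associative if and only if $k=0$.
   Context: The $n$th Weyl algebra $A_n$ over $K$ is the free associative unital $K$-algebra on $x_1,\ldots,x_n,y_1,\ldots,y_n$ modulo the relations $[x_i,x_j]=[y_i,y_j]=0$ and $[x_i,y_j]=\delta_{ij}$ (Kronecker delta, times $1_{A_n}$) for $1\le i,j\le n$. For $k=(k_1,\ldots,k_n)\in K^n$, let $\widehat\alpha_k\colon A_n\to A_n$ be the unital $K$-algebra endomorphism with $\widehat\alpha_k(x_\ell)=x_\ell$ and $\widehat\alpha_k(y_\ell)=y_\ell+k_\ell$ for $1\le\ell\le n$. The $n$th hom-associative Weyl algebra $A_n^k$ is the $K$-vector space $A_n$ equipped with the (in general nonassociative, nonunital) multiplication $p*q:=\widehat\alpha_k(pq)$ (where $pq$ is the product in $A_n$) and with twisting map $\widehat\alpha_k$; it satisfies $\widehat\alpha_k(a)*(b*c)=(a*b)*\widehat\alpha_k(c)$. A weak identity element of $A_n^k$ is an element $e$ with $a*e=e*a=\widehat\alpha_k(a)$ for all $a$. A nonzero element $a$ of a nonassociative algebra is a zero divisor if there is a nonzero $b$ with $ab=0$ or a nonzero $b$ with $ba=0$. A nonassociative algebra is called power-associative if $(aa)a=a(aa)$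 for all its elements $a$. *)

(* Defs.v *)
From HB Require Import structures.
From mathcomp Require Import all_boot all_algebra.
From mathcomp Require Import generic_quotient ring_quotient finmap boolp.
From mathcomp Require Import monalg.
From mathcomp Require mpoly.

Set Implicit Arguments.
Unset Strict Implicit.
Unset Printing Implicit Defensive.

Import GRing.Theory.
Local Open Scope ring_scope.
Local Open Scope quotient_scope.

(* K<T>: the monoid algebra over K of the free monoid on T. *)
Definition free_alg (K : fieldType) (T : choiceType) : Type :=
  {malg K[{fmonom T}]}.

(* Locked so that conversion does not unfold the convolution product. *)
HB.lock Definition free_mul (K : fieldType) (T : choiceType)
  (f g : free_alg K T) : free_alg K T := @fgmul {fmonom T} K f g.

Section FreeAlgebra.
Variables (K : fieldType) (T : choiceType).
Local Notation F := (free_alg K T).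
Local Notation "f *f g" := (@free_mul K T f g) (at level 40).

HB.instance Definition _ := Choice.on F.
HB.instance Definition _ := GRing.Lmodule.on F.

Fact free_mulE (f g : F) : f *f g = @fgmul {fmonom T} K f g.
Proof. by rewrite free_mul.unlock. Qed.

Fact free_mulA : associative (@free_mul K T).
Proof. by move=> f g h; rewrite !free_mulE; apply: fgmulA. Qed.

Fact free_mul1 : left_id (fgone {fmonom T} K) (@free_mul K T).
Proof. by move=> f; rewrite free_mulE; apply: fgmul1g. Qed.

Fact free_mulr1 : right_id (fgone {fmonom T} K) (@free_mul K T).
Proof. by move=> f; rewrite free_mulE; apply: fgmulg1. Qed.

Fact free_mulDl : left_distributive (@free_mul K T) +%R.
Proof. by move=> f g h; rewrite !free_mulE; apply: fgmulgDl. Qed.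

Fact free_mulDr : right_distributive (@free_mul K T) +%R.
Proof. by move=> f g h; rewrite !free_mulE; apply: fgmulgDr. Qed.

HB.instance Definition _ := GRing.Zmodule_isNzRing.Build F
  free_mulA free_mul1 free_mulr1 free_mulDl free_mulDr
  (fgoner_eq0 {fmonom T} K).

Lemma free_mulrE (f g : F) : f * g = @fgmul {fmonom T} K f g.
Proof. exact: free_mulE. Qed.

Fact free_scaleAl (c : K) (f g : F) : c *: (f *f g) = (c *: f) *f g.
Proof. by rewrite !free_mulE; apply: fgscaleAl. Qed.
HB.instance Definition _ := GRing.Lmodule_isLalgebra.Build K F free_scaleAl.

Lemma free_sumE (f : F) : f = \sum_(m <- msupp f) (<< f@_m *g m >> : F).
Proof. exact: monalgE. Qed.

Lemma free_mulUU c d m m' :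
  (<< c *g m >> : F) * (<< d *g m' >> : F) = << c * d *g mmul m m' >>.
Proof. by rewrite free_mulrE fgmulUU. Qed.

Lemma free_scaleE c (f : F) : c *: f = (<< c *g @mone {fmonom T} >> : F) * f.
Proof. by rewrite free_mulrE; apply/esym/mul_malgC. Qed.

Fact free_scaleAr (c : K) (f g : F) : c *: (f * g) = f * (c *: g).
Proof.
suff cfC : (<< c *g @mone {fmonom T} >> : F) * f = f * << c *g @mone {fmonom T} >>.
  by rewrite !free_scaleE (mulrA _ f g) cfC -(mulrA f).
rewrite [f]free_sumE mulr_sumr mulr_suml; apply: eq_bigr => m _.
by rewrite !free_mulUU mul1m mulm1 mulrC.
Qed.
HB.instance Definition _ := GRing.Lalgebra_isAlgebra.Build K F free_scaleAr.

Definition free_gen (t : T) : F := << fmu t >>.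

(* The algebra morphism K<T> -> B extending h : T -> B. *)
Section Evaluation.
Variables (B : algType K) (h : T -> B).

Definition word_eval (m : {fmonom T}) : B := \prod_(t <- (m : seq T)) h t.

Fact word_eval_is_mmorphism : mmorphism word_eval.
Proof.
split=> [m1 m2|]; rewrite /word_eval.
  by rewrite fmM big_cat.
by rewrite fm1 big_nil.
Qed.
HB.instance Definition _ := monalg.isMultiplicative.Build {fmonom T} B
  word_eval word_eval_is_mmorphism.

Definition free_eval (f : F) : B := mmap (GRing.in_alg B) word_eval f.

Fact free_eval_is_zmod_morphism : zmod_morphism free_eval.
Proof. exact: mmap_is_additive. Qed.
HB.instance Definition _ := GRing.isZmodMorphism.Build F B free_eval
  free_eval_is_zmod_morphism.

Fact free_eval_is_monoid_morphism : monoid_morphism free_eval.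
Proof.
have comm (f : F) m m' : GRing.comm (GRing.in_alg B f@_m) (word_eval m').
  by rewrite /GRing.comm /= -scalerAl -scalerAr mul1r mulr1.
have [fM f1] := commr_mmap_is_multiplicative comm.
by split=> // f g; rewrite free_mulrE; apply: fM.
Qed.
HB.instance Definition _ := GRing.isMonoidMorphism.Build F B free_eval
  free_eval_is_monoid_morphism.

Fact free_eval_is_scalable : scalable free_eval.
Proof. by move=> c f; rewrite /free_eval mmapZ /= mulr_algl. Qed.
HB.instance Definition _ := GRing.isScalable.Build K F B *:%R free_eval
  free_eval_is_scalable.

Lemma free_eval_gen t : free_eval (free_gen t) = h t.
Proof.
by rewrite /free_eval /free_gen mmapU /= scale1r mul1r /word_eval fmU big_seq1.
Qed.

End Evaluation.

(* The K<T>-module structure on V in which t : T acts by op t. *)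
Section Action.
Variables (V : lmodType K) (op : T -> {linear V -> V}).

Definition word_act (m : {fmonom T}) (v : V) : V :=
  foldr (fun t => op t) v (m : seq T).

Definition free_act (f : F) (v : V) : V :=
  \sum_(m <- msupp f) f@_m *: word_act m v.


Fact word_act_is_linear m : linear (word_act m).
Proof.
move=> c u v; rewrite /word_act; elim: (m : seq T) => //= t s ->.
by rewrite linearP.
Qed.
HB.instance Definition _ m := GRing.isLinear.Build K V V *:%R (word_act m)
  (word_act_is_linear m).

Lemma free_actEw (d : {fset {fmonom T}}) (f : F) v :
  fsubset (msupp f) d -> free_act f v = \sum_(m <- d) f@_m *: word_act m v.
Proof.
move=> le; rewrite /free_act (big_fset_incl _ le) //= => m _ /mcoeff_outdom ->.
by rewrite scale0r.
Qed.

Lemma free_actU c m v : free_act << c *g m >> v = c *: word_act m v.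
Proof. by rewrite (free_actEw _ msuppU_le) big_seq_fset1 mcoeffUU. Qed.

Lemma free_actD f g v : free_act (f + g) v = free_act f v + free_act g v.
Proof.
pose d := fsetU (msupp f) (msupp g).
rewrite (@free_actEw d f) ?fsubsetUl // (@free_actEw d g) ?fsubsetUr //.
rewrite (@free_actEw d) ?msuppD_le // -big_split /=.
by apply: eq_bigr => m _; rewrite mcoeffD scalerDl.
Qed.

Lemma free_act0 v : free_act 0 v = 0.
Proof. by rewrite /free_act msupp0 big_seq_fset0. Qed.

Lemma free_act_sum (I : Type) (r : seq I) (G : I -> F) v :
  free_act (\sum_(i <- r) G i) v = \sum_(i <- r) free_act (G i) v.
Proof.
exact: (big_morph (free_act^~ v) (fun f g => free_actD f g v) (free_act0 v)).
Qed.

Fact free_act_is_linear f : linear (free_act f).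
Proof.
move=> c u v; rewrite /free_act scaler_sumr -big_split /=.
by apply: eq_bigr => m _; rewrite linearP scalerDr !scalerA mulrC.
Qed.
HB.instance Definition _ f := GRing.isLinear.Build K V V *:%R (free_act f)
  (free_act_is_linear f).

Lemma free_actM f g v : free_act (f * g) v = free_act f (free_act g v).
Proof.
rewrite [f]free_sumE mulr_suml !free_act_sum; apply: eq_bigr => m _.
rewrite [in LHS](free_sumE g) [in RHS](free_sumE g) mulr_sumr !free_act_sum.
rewrite linear_sum /=.
apply: eq_bigr => m' _.
rewrite free_mulUU !free_actU linearZ scalerA; congr (_ *: _).
by rewrite /word_act fmM foldr_cat.
Qed.

Lemma free_act1 v : free_act 1 v = v.
Proof. by rewrite free_actU scale1r /word_act fm1. Qed.

Lemma free_actZ c f v : free_act (c *: f) v = c *: free_act f v.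
Proof.
by rewrite free_scaleE free_actM free_actU /word_act fm1.
Qed.

Lemma free_act_gen t v : free_act (free_gen t) v = op t v.
Proof. by rewrite free_actU scale1r /word_act fmU. Qed.

End Action.
End FreeAlgebra.


Section WeylAlgebra.
Variables (K : fieldType) (n : nat).

(* inl i and inr i are the letters x_i and y_i. *)
Local Notation F := (free_alg K ('I_n + 'I_n)%type).
Local Notation fX i := (free_gen K (inl i : 'I_n + 'I_n)).
Local Notation fY i := (free_gen K (inr i : 'I_n + 'I_n)).

Inductive weyl_relator : F -> Prop :=
| WeylXX i j : weyl_relator (fX i * fX j - fX j * fX i)
| WeylYY i j : weyl_relator (fY i * fY j - fY j * fY i)
| WeylXY i j : weyl_relator (fX i * fY j - fY j * fX i - (i == j)%:R).

(* The two-sided ideal generated by the relators; it is closed under negation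
   and scaling because a absorbs scalars. *)
Inductive weyl_ideal : F -> Prop :=
| WeylIdeal0 : weyl_ideal 0
| WeylIdealD f g : weyl_ideal f -> weyl_ideal g -> weyl_ideal (f + g)
| WeylIdealM a r b : weyl_relator r -> weyl_ideal (a * r * b).

Lemma weyl_idealMl a f : weyl_ideal f -> weyl_ideal (a * f).
Proof.
elim=> [|{}f g _ If _ Ig|b r c rr]; first by rewrite mulr0; exact: WeylIdeal0.
  by rewrite mulrDr; apply: WeylIdealD.
by rewrite !mulrA; apply: WeylIdealM.
Qed.

Lemma weyl_idealMr a f : weyl_ideal f -> weyl_ideal (f * a).
Proof.
elim=> [|{}f g _ If _ Ig|b r c rr]; first by rewrite mul0r; exact: WeylIdeal0.
  by rewrite mulrDl; apply: WeylIdealD.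
by rewrite -mulrA; apply: WeylIdealM.
Qed.

Definition weyl_ideal_pred : {pred F} := fun f => `[< weyl_ideal f >].

Fact weyl_ideal_zmod_closed : zmod_closed weyl_ideal_pred.
Proof.
split=> [|f g /asboolP If /asboolP Ig]; apply/asboolP; first exact: WeylIdeal0.
by apply: WeylIdealD => //; rewrite -mulN1r; apply: weyl_idealMl.
Qed.
HB.instance Definition _ := GRing.isZmodClosed.Build F weyl_ideal_pred
  weyl_ideal_zmod_closed.

Definition weyl : Type := {ideal_quot weyl_ideal_pred}.
HB.instance Definition _ := Choice.on weyl.
HB.instance Definition _ := GRing.Zmodule.on weyl.
HB.instance Definition _ := EqQuotient.on weyl.

Lemma weyl_piP (f g : F) :
  weyl_ideal (f - g) <-> \pi_weyl f = \pi_weyl g.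
Proof.
split=> [If|/eqP]; last by rewrite -(Quotient.idealrBE weyl_ideal_pred) => /asboolP.
by apply/eqP; rewrite -(Quotient.idealrBE weyl_ideal_pred); apply/asboolP.
Qed.

Lemma weyl_repr_pi (f : F) : weyl_ideal (repr (\pi_weyl f) - f).
Proof. by apply/weyl_piP; rewrite reprK. Qed.

Lemma weyl_pi0 : \pi_weyl (0 : F) = 0.
Proof. exact: (pi_zeror (s := {ideal_quot weyl_ideal_pred})). Qed.

Lemma weyl_piD (f g : F) : \pi_weyl (f + g) = \pi_weyl f + \pi_weyl g.
Proof. exact: (pi_addr (s := {ideal_quot weyl_ideal_pred})). Qed.

Definition weyl_one : weyl := \pi_weyl 1.
Definition weyl_mul := lift_op2 weyl (fun f g : F => f * g).
Definition weyl_scale (c : K) := lift_op1 weyl (fun f : F => c *: f).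

Lemma weyl_piM (f g : F) : weyl_mul (\pi_weyl f) (\pi_weyl g) = \pi_weyl (f * g).
Proof.
unlock weyl_mul; apply/weyl_piP; set f' := repr _; set g' := repr _.
have ->: f' * g' - f * g = (f' - f) * g' + f * (g' - g).
  by rewrite mulrBl mulrBr addrA subrK.
apply: WeylIdealD; first by apply/weyl_idealMr/weyl_repr_pi.
exact/weyl_idealMl/weyl_repr_pi.
Qed.

Lemma weyl_piZ c (f : F) : weyl_scale c (\pi_weyl f) = \pi_weyl (c *: f).
Proof.
unlock weyl_scale; apply/weyl_piP; rewrite -scalerBr -mulr_algl.
exact/weyl_idealMl/weyl_repr_pi.
Qed.

Fact weyl_mulA : associative weyl_mul.
Proof.
move=> a b c; elim/quotW: a => a; elim/quotW: b => b; elim/quotW: c => c.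
by rewrite !weyl_piM mulrA.
Qed.

Fact weyl_mul1 : left_id weyl_one weyl_mul.
Proof. by move=> a; elim/quotW: a => a; rewrite weyl_piM mul1r. Qed.

Fact weyl_mulr1 : right_id weyl_one weyl_mul.
Proof. by move=> a; elim/quotW: a => a; rewrite weyl_piM mulr1. Qed.

Fact weyl_mulDl : left_distributive weyl_mul +%R.
Proof.
move=> a b c; elim/quotW: a => a; elim/quotW: b => b; elim/quotW: c => c.
by rewrite -weyl_piD !weyl_piM mulrDl weyl_piD.
Qed.

Fact weyl_mulDr : right_distributive weyl_mul +%R.
Proof.
move=> a b c; elim/quotW: a => a; elim/quotW: b => b; elim/quotW: c => c.
by rewrite -weyl_piD !weyl_piM mulrDr weyl_piD.
Qed.

End WeylAlgebra.

Section WeylNonzero.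
Import -(notations) mpoly.
Variables (K : fieldType) (n : nat).
Local Notation V := (mpoly.mpoly n K).
Local Notation fX i := (free_gen K (inl i : 'I_n + 'I_n)).
Local Notation fY i := (free_gen K (inr i : 'I_n + 'I_n)).

(* A_n is nonzero: it acts on K[X_1, ..., X_n], x_i as the i-th partial
   derivative and y_i as multiplication by X_i. *)
Fact weyl_one_neq0 : weyl_one K n != 0.
Proof.
pose var i : V := mpoly.mpolyX K (mpoly.mnm1 i).
pose op (t : 'I_n + 'I_n) : {linear V -> V} :=
  match t with
  | inl i => mpoly.mderiv i
  | inr i => var i \*o idfun
  end.
have I0 f : weyl_ideal f -> forall v : V, free_act op f v = 0.
  elim=> [|{}f g _ If _ Ig|a r b rr] v; first exact: free_act0.
    by rewrite free_actD If Ig addr0.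
  rewrite !free_actM; move: (free_act op b v) => {}v.
  suff ->: free_act op r v = 0 by rewrite linear0.
  have actB p q : free_act op (p - q) v = free_act op p v - free_act op q v.
    by rewrite -[- q]scaleN1r free_actD free_actZ scaleN1r.
  have actM t t' : free_act op (free_gen K t * free_gen K t') v = op t (op t' v).
    by rewrite free_actM !free_act_gen.
  case: rr => i j.
  - rewrite (actB (fX i * fX j) (fX j * fX i)).
    rewrite (actM (inl i) (inl j)) (actM (inl j) (inl i)) /=.
    by rewrite mpoly.mderiv_comm subrr.
  - rewrite (actB (fY i * fY j) (fY j * fY i)).
    rewrite (actM (inr i) (inr j)) (actM (inr j) (inr i)) /=.
    by rewrite mulrCA subrr.
  - rewrite (actB (fX i * fY j - fY j * fX i)) (actB (fX i * fY j)).
    rewrite (actM (inl i) (inr j)) (actM (inr j) (inl i)) /=.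
    rewrite mpoly.mderivM mpoly.mderivX addrK.
    rewrite mpoly.mnm1E; case: (eqVneq i j) => [<-|_]; last first.
      by rewrite scale0r mul0r free_act0 subrr.
    rewrite ?eqxx scale1r; set m := mpoly.mnm_sub _ _.
    have ->: m = mpoly.mnm0.
      by apply/mpoly.mnmP => l; rewrite mpoly.mnmBE mpoly.mnm0E subnn.
    by rewrite mpoly.mpolyX0 mul1r free_act1 subrr.
apply/eqP; rewrite -weyl_pi0 => /weyl_piP; rewrite subr0 => /I0/(_ (1 : V)).
by rewrite free_act1; apply/eqP; rewrite oner_eq0.
Qed.

End WeylNonzero.

Section WeylAlgebraStructure.
Variables (K : fieldType) (n : nat).
Local Notation F := (free_alg K ('I_n + 'I_n)%type).
Local Notation weyl := (weyl K n).
Local Notation weyl_mul := (@weyl_mul K n).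
Local Notation weyl_scale := (@weyl_scale K n).

HB.instance Definition _ := GRing.Zmodule_isNzRing.Build weyl
  (@weyl_mulA K n) (@weyl_mul1 K n) (@weyl_mulr1 K n) (@weyl_mulDl K n)
  (@weyl_mulDr K n) (weyl_one_neq0 K n).

Fact weyl_scaleA c d a : weyl_scale c (weyl_scale d a) = weyl_scale (c * d) a.
Proof. by elim/quotW: a => a; rewrite !weyl_piZ scalerA. Qed.

Fact weyl_scale1 : left_id 1 weyl_scale.
Proof. by move=> a; elim/quotW: a => a; rewrite weyl_piZ scale1r. Qed.

Fact weyl_scaleDr : right_distributive weyl_scale +%R.
Proof.
move=> c a b; elim/quotW: a => a; elim/quotW: b => b.
by rewrite -weyl_piD !weyl_piZ scalerDr weyl_piD.
Qed.

Fact weyl_scaleDl a : {morph weyl_scale^~ a : c d / c + d}.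
Proof. by move=> c d; elim/quotW: a => a; rewrite !weyl_piZ scalerDl weyl_piD. Qed.

HB.instance Definition _ := GRing.Zmodule_isLmodule.Build K weyl
  weyl_scaleA weyl_scale1 weyl_scaleDr weyl_scaleDl.

Fact weyl_scaleAl c a b :
  weyl_scale c (weyl_mul a b) = weyl_mul (weyl_scale c a) b.
Proof.
elim/quotW: a => a; elim/quotW: b => b.
by rewrite !(weyl_piM, weyl_piZ) scalerAl.
Qed.
HB.instance Definition _ := GRing.Lmodule_isLalgebra.Build K weyl weyl_scaleAl.

Fact weyl_scaleAr c a b :
  weyl_scale c (weyl_mul a b) = weyl_mul a (weyl_scale c b).
Proof.
elim/quotW: a => a; elim/quotW: b => b.
by rewrite !(weyl_piM, weyl_piZ) scalerAr.
Qed.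
HB.instance Definition _ := GRing.Lalgebra_isAlgebra.Build K weyl weyl_scaleAr.

Definition weyl_proj (f : F) : weyl := \pi_weyl f.

Fact weyl_proj_is_zmod_morphism : zmod_morphism weyl_proj.
Proof. by move=> f g; apply/(canRL (addrK _)); rewrite -weyl_piD subrK. Qed.
HB.instance Definition _ := GRing.isZmodMorphism.Build F weyl weyl_proj
  weyl_proj_is_zmod_morphism.

Fact weyl_proj_is_monoid_morphism : monoid_morphism weyl_proj.
Proof. by split=> // f g; rewrite /weyl_proj -weyl_piM. Qed.
HB.instance Definition _ := GRing.isMonoidMorphism.Build F weyl weyl_proj
  weyl_proj_is_monoid_morphism.

Fact weyl_proj_is_scalable : scalable weyl_proj.
Proof. by move=> c f; rewrite /weyl_proj -weyl_piZ. Qed.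
HB.instance Definition _ := GRing.isScalable.Build K F weyl *:%R weyl_proj
  weyl_proj_is_scalable.

Definition weylX (i : 'I_n) : weyl :=
  weyl_proj (free_gen K (inl i : 'I_n + 'I_n)).
Definition weylY (i : 'I_n) : weyl :=
  weyl_proj (free_gen K (inr i : 'I_n + 'I_n)).

Definition weyl_relations (B : algType K) (x y : 'I_n -> B) : Prop :=
  forall i j, [/\ x i * x j - x j * x i = 0,
                  y i * y j - y j * y i = 0
                & x i * y j - y j * x i = (i == j)%:R].

Fact weyl_relationsP : weyl_relations weylX weylY.
Proof.
have proj0 (f : F) : weyl_relator f -> weyl_proj f = 0.
  move=> rf; rewrite /weyl_proj -weyl_pi0; apply/weyl_piP; rewrite subr0.
  by rewrite -[f]mul1r -[1 * f]mulr1; apply: WeylIdealM.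
move=> i j; split; rewrite /weylX /weylY -!rmorphM -rmorphB /=.
- exact/proj0/WeylXX.
- exact/proj0/WeylYY.
- apply/eqP; rewrite -subr_eq0 -(rmorph_nat weyl_proj) -rmorphB /=.
  exact/eqP/proj0/WeylXY.
Qed.

(* Universal property: the algebra morphism A_n -> B with x_i |-> x i and
   y_i |-> y i. *)
Section Lift.
Variables (B : algType K) (x y : 'I_n -> B).

Definition weyl_gens (t : 'I_n + 'I_n) : B :=
  match t with inl i => x i | inr i => y i end.

Definition weyl_lift of weyl_relations x y := fun a : weyl =>
  free_eval weyl_gens (repr a).

Hypothesis relxy : weyl_relations x y.

Lemma free_eval_ideal (f : F) : weyl_ideal f -> free_eval weyl_gens f = 0.
Proof.
elim=> [|{}f g _ If _ Ig|a r b rr]; first exact: rmorph0.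
  by rewrite rmorphD /= If Ig addr0.
rewrite !rmorphM /=; suff ->: free_eval weyl_gens r = 0 by rewrite mulr0 mul0r.
case: rr => i j; have [xx yy xy] := relxy i j.
- by rewrite rmorphB !rmorphM /= !free_eval_gen.
- by rewrite rmorphB !rmorphM /= !free_eval_gen.
- by rewrite !rmorphB !rmorphM rmorph_nat /= !free_eval_gen /= xy subrr.
Qed.

Lemma weyl_lift_proj (f : F) :
  weyl_lift relxy (weyl_proj f) = free_eval weyl_gens f.
Proof.
apply/eqP; rewrite -subr_eq0 -rmorphB; apply/eqP/free_eval_ideal.
exact: weyl_repr_pi.
Qed.

Fact weyl_lift_is_zmod_morphism : zmod_morphism (weyl_lift relxy).
Proof.
move=> a b; elim/quotW: a => f; elim/quotW: b => g.
by rewrite -/(weyl_proj f) -/(weyl_proj g) -rmorphB /= !weyl_lift_proj rmorphB.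
Qed.
HB.instance Definition _ := GRing.isZmodMorphism.Build weyl B (weyl_lift relxy)
  weyl_lift_is_zmod_morphism.

Fact weyl_lift_is_monoid_morphism : monoid_morphism (weyl_lift relxy).
Proof.
split=> [|a b]; first by rewrite -(rmorph1 weyl_proj) weyl_lift_proj rmorph1.
elim/quotW: a => f; elim/quotW: b => g.
by rewrite -/(weyl_proj f) -/(weyl_proj g) -rmorphM /= !weyl_lift_proj rmorphM.
Qed.
HB.instance Definition _ := GRing.isMonoidMorphism.Build weyl B
  (weyl_lift relxy) weyl_lift_is_monoid_morphism.

Fact weyl_lift_is_scalable : scalable (weyl_lift relxy).
Proof.
move=> c a; elim/quotW: a => f.
by rewrite -/(weyl_proj f) -linearZ /= !weyl_lift_proj linearZ.
Qed.
HB.instance Definition _ := GRing.isScalable.Build K weyl B *:%R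
  (weyl_lift relxy) weyl_lift_is_scalable.

Lemma weyl_liftX i : weyl_lift relxy (weylX i) = x i.
Proof. by rewrite weyl_lift_proj free_eval_gen. Qed.

Lemma weyl_liftY i : weyl_lift relxy (weylY i) = y i.
Proof. by rewrite weyl_lift_proj free_eval_gen. Qed.

End Lift.

Fact weyl_shift_relations (k : 'rV[K]_n) :
  weyl_relations weylX (fun l => weylY l + (k 0 l)%:A).
Proof.
have comA (c : K) (a b : weyl) : a * (b + c%:A) - (b + c%:A) * a = a * b - b * a.
  by rewrite mulrDr mulrDl mulr_algr mulr_algl opprD addrACA subrr addr0.
move=> i j; have [xx yy xy] := weyl_relationsP i j; split=> //.
  by rewrite comA -opprB comA opprB.
by rewrite comA.
Qed.

(* The endomorphism with x_l |-> x_l and y_l |-> y_l + k_l. *)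
Definition weyl_shift (k : 'rV[K]_n) : {lrmorphism weyl -> weyl} :=
  weyl_lift (weyl_shift_relations k).

Lemma weyl_shiftX k l : weyl_shift k (weylX l) = weylX l.
Proof. exact: weyl_liftX. Qed.

Lemma weyl_shiftY k l : weyl_shift k (weylY l) = weylY l + (k 0 l)%:A.
Proof. exact: weyl_liftY. Qed.

End WeylAlgebraStructure.

Record homAlgebra (K : fieldType) := HomAlgebra {
  hcarrier :> lmodType K;
  hmul : hcarrier -> hcarrier -> hcarrier;
  htwist : {linear hcarrier -> hcarrier};
  hmul_linearl : forall b, linear (hmul^~ b);
  hmul_linearr : forall a, linear (hmul a);
  hmul_homA : forall a b c,
    hmul (htwist a) (hmul b c) = hmul (hmul a b) (htwist c) }.

Section YauTwist.
Variables (K : fieldType) (A : algType K) (alpha : {lrmorphism A -> A}).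

Let tmul (p q : A) : A := alpha (p * q).

Fact yau_linearl b : linear (tmul^~ b).
Proof. by move=> c a a'; rewrite /tmul mulrDl -scalerAl linearP. Qed.

Fact yau_linearr a : linear (tmul a).
Proof. by move=> c b b'; rewrite /tmul mulrDr -scalerAr linearP. Qed.

Fact yau_homA a b c : tmul (alpha a) (tmul b c) = tmul (tmul a b) (alpha c).
Proof. by rewrite /tmul -!rmorphM mulrA. Qed.

Definition yau_twist : homAlgebra K :=
  @HomAlgebra K A tmul alpha yau_linearl yau_linearr yau_homA.

End YauTwist.

Definition hom_weyl (K : fieldType) (n : nat) (k : 'rV[K]_n) : homAlgebra K :=
  yau_twist (weyl_shift k).

Section HomAlgebraNotions.
Variables (K : fieldType) (A : homAlgebra K).
Local Notation "a *h b" := (@hmul K A a b) (at level 40, left associativity).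

Definition weak_identity (e : A) : Prop :=
  forall a : A, a *h e = htwist A a /\ e *h a = htwist A a.

Definition zero_divisor (a : A) : Prop :=
  a != 0 /\ ((exists2 b : A, b != 0 & a *h b = 0) \/
             (exists2 b : A, b != 0 & b *h a = 0)).

Definition power_associative : Prop :=
  forall a : A, (a *h a) *h a = a *h (a *h a).

(* K is isomorphic, as a K-algebra, to a subalgebra of A.  A need not have a
   unit, so f 1 is only required to be the unit of the image. *)
Definition field_embeds : Prop :=
  exists2 f : {linear K^o -> A},
    injective f & forall c d : K, f (c * d) = f c *h f d.

End HomAlgebraNotions.

(* Main.v *)
(* Since alpha_k is invertible (its inverse is alpha_(-k)), everything reduces to
   A_n itself, and the main point is that A_n has no zero divisors.  The inner
   derivations D_t = [h_t, -], with h_t conjugate to the generator g_t up to sign,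
   commute and are locally nilpotent.  In characteristic zero, the Leibniz rule
   for the highest nonvanishing powers of a locally nilpotent derivation lifts the
   absence of zero divisors from its kernel to the whole algebra; applying this to
   the D_t one at a time leaves their joint kernel.  That kernel is K: the Euler
   operator sum_t g_t D_t acts as multiplication by d on elements of degree <= d
   modulo lower degree, so an element it annihilates has degree 0.
   For the failure of power-associativity take a = x_l y_l with k_l <> 0: then
   alpha_k(a) = a + k_l x_l, and its square does not commute with a. *)

From HB Require Import structures.
Require Import Defs.
From mathcomp Require Import all_boot all_algebra.
From mathcomp Require Import monalg.
Import GRing.Theory.
Local Open Scope ring_scope.

Set Implicit Arguments.
Unset Strict Implicit.
Unset Printing Implicit Defensive.

(** * Locally nilpotent derivations *)

Section LocallyNilpotent.
Variables (R : nzRingType) (D : {additive R -> R}).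
Hypothesis D_leibniz : forall a b, D (a * b) = D a * b + a * D b.

(** Only the top term of the iterated Leibniz rule survives. In the double induction [D (a * b)]
    splits into the cases [(D a, b)] and [(a, D b)], whose binomial coefficients add up by Pascal's
    rule. *)
Lemma iter_derivation_top (m p : nat) (a b : R) :
    iter m.+1 D a = 0 -> iter p.+1 D b = 0 ->
  iter (m + p) D (a * b) = (iter m D a * iter p D b) *+ 'C(m + p, m).
Proof.
have iterD i u v : iter i D (u + v) = iter i D u + iter i D v.
  by elim: i => //= i ->; rewrite raddfD.
elim: m p a b => [|m IHm] p a b Da.
  rewrite /= in Da => _; rewrite add0n bin0 mulr1n.
  by elim: p => //= q ->; rewrite D_leibniz Da mul0r add0r.
elim: p a b Da => [|p IHp] a b Da Db.
  rewrite /= in Db; rewrite addn0 binn mulr1n {IHm Da}; move: m.+1 => q.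
  by elim: q => //= q ->; rewrite D_leibniz Db mulr0 addr0.
have DaDb := IHp a (D b) Da; rewrite -!iterSr in DaDb.
have {}IHm := IHm p.+1 (D a) b; rewrite -!iterSr in IHm.
rewrite addSn iterSr D_leibniz iterD IHm // -addSnnS DaDb //.
by rewrite -mulrnDr addSnnS binS addnC.
Qed.

(* If [m] and [p] are maximal with [D^m a <> 0] and [D^p b <> 0], then
   [D^(m+p) (a b)] is a nonzero multiple of [D^m a * D^p b]. *)
Lemma mul_eq0_of_kernel (P : R -> Prop) :
    (forall (a : R) n, a *+ n.+1 = 0 -> a = 0) ->
    (forall a, exists n, iter n D a = 0) ->
    (forall a, P a -> P (D a)) ->
    (forall a b, P a -> P b -> D a = 0 -> D b = 0 ->
      a * b = 0 -> a = 0 \/ b = 0) ->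
  forall a b, P a -> P b -> a * b = 0 -> a = 0 \/ b = 0.
Proof.
move=> char0 nilD PD dom a b Pa Pb ab0.
have iterP i u : P u -> P (iter i D u) by elim: i => //= i IH /IH/PD.
have last_iter u : u = 0 \/ exists2 m, iter m D u <> 0 & iter m.+1 D u = 0.
  have ex : exists m, iter m D u == 0 by have [m] := nilD u; exists m; apply/eqP.
  case: (ex_minnP ex) => -[|m] /eqP um0 min; [by left | right; exists m => //].
  by move/eqP/min; rewrite ltnn.
have [|[m am amS]] := last_iter a; first by left.
have [|[p bp bpS]] := last_iter b; first by right.
have := iter_derivation_top amS bpS; rewrite ab0.
have -> : iter (m + p) D 0 = 0 by elim: (m + p)%N => //= i ->; rewrite raddf0.
have := leq_addr p m; rewrite -bin_gt0; case: 'C(_, _) => // c _ /esym/char0.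
by case/(dom _ _ (iterP m a Pa) (iterP p b Pb) amS bpS).
Qed.

End LocallyNilpotent.

(** * Inner derivations *)

Section Commutator.
Variables (K : fieldType) (A : algType K).

Definition comm_with (u a : A) : A := u * a - a * u.

Fact comm_with_is_linear u : linear (comm_with u).
Proof.
move=> c a b; rewrite /comm_with mulrDr mulrDl scalerBr -scalerAr -scalerAl.
by rewrite opprD addrACA.
Qed.
HB.instance Definition _ u := GRing.isLinear.Build K A A *:%R (comm_with u)
  (comm_with_is_linear u).

Lemma comm_with_leibniz u a b :
  comm_with u (a * b) = comm_with u a * b + a * comm_with u b.
Proof. by rewrite /comm_with mulrBl mulrBr !mulrA addrA subrK. Qed.

Lemma comm_with_scalar u c : comm_with u c%:A = 0.
Proof. by rewrite /comm_with mulr_algr mulr_algl subrr. Qed.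

(** Jacobi identity: the two sides differ by [[[u, v], a]], and scalars are central. *)
Lemma comm_with_comm u v c a : comm_with u v = c%:A ->
  comm_with u (comm_with v a) = comm_with v (comm_with u a).
Proof.
move=> uv; rewrite [comm_with v a]/comm_with linearB /= !comm_with_leibniz uv.
by rewrite mulr_algl mulr_algr opprD [X in _ + X]addrC addrACA subrr add0r.
Qed.

(** Here [u] is the shifted image of [a = x * y]. From [u = a + c *: x] come [[a, u] = - c *: x] and
    [[x, u] = x]; the outer commutator with [x] removes [y] and leaves a multiple of [x * x]. *)
Lemma comm_with_square_shift x y c (u := x * (y + c%:A)) :
    comm_with x y = 1 ->
  comm_with x (comm_with (x * y) (u * u)) = - c *: ((x * x) *+ 2).
Proof.
move=> xy; set a := x * y.
have xx : comm_with x x = 0 by rewrite /comm_with subrr.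
have xa : comm_with x a = x by rewrite comm_with_leibniz xx xy mul0r add0r mulr1.
have ax : comm_with a x = - x by rewrite -[in RHS]xa /comm_with opprB.
have uE : u = a + c *: x by rewrite /u mulrDr mulr_algr.
have aa : comm_with a a = 0 by rewrite /comm_with subrr.
clearbody a u; have au : comm_with a u = - c *: x.
  by rewrite uE linearD linearZ /= ax aa add0r scalerN scaleNr.
have xu : comm_with x u = x.
  by rewrite uE linearD linearZ /= xa xx scaler0 addr0.
rewrite (comm_with_leibniz a) au -scalerAl -scalerAr -scalerDr linearZ linearD /=.
by rewrite !comm_with_leibniz xu xx mul0r mulr0 add0r addr0 mulr2n.
Qed.

End Commutator.

(* An algebra generated by a finite family [g] that satisfies canonical
   commutation relations: [h t] is, up to sign, the generator conjugate to
   [g t]. *)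
Section CanonicalCommutation.
Variables (K : fieldType) (A : algType K) (T : finType) (g h : T -> A).
Hypothesis charK0 : [pchar K] =i pred0.
Hypothesis ccr : forall s t, comm_with (h s) (g t) = (s == t)%:R.
Hypothesis gg_scalar : forall s t, exists c : K, comm_with (g s) (g t) = c%:A.
Hypothesis hh_scalar : forall s t, exists c : K, comm_with (h s) (h t) = c%:A.

Local Notation D t := (comm_with (h t)).

(** A filtration by word length, peeling off the leftmost generator; it avoids any basis of ordered
    monomials. The strict bound puts 0 alone at level 0 and the scalars at level 1. *)
Fixpoint degree_lt (d : nat) (a : A) : Prop :=
  if d is d'.+1 then
    exists c : K, exists2 b : T -> A,
      forall t, degree_lt d' (b t) & a = c%:A + \sum_t g t * b t
  else a = 0.

Lemma degree_lt0 d : degree_lt d 0.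
Proof.
elim: d => //= d IH; exists 0, (fun=> 0) => //.
by rewrite scale0r add0r big1 // => t _; rewrite mulr0.
Qed.

Lemma degree_lt_linear d c a b :
  degree_lt d a -> degree_lt d b -> degree_lt d (c *: a + b).
Proof.
elim: d a b => [|d IH] a b /=; first by move=> -> ->; rewrite scaler0 addr0.
move=> [ca [a' a'd ->]] [cb [b' b'd ->]].
exists (c * ca + cb), (fun t => c *: a' t + b' t) => [t|]; first exact: IH.
rewrite scalerDr scalerA scalerDl addrACA; congr (_ + _).
rewrite scaler_sumr -big_split /=; apply: eq_bigr => t _.
by rewrite mulrDr -scalerAr.
Qed.

Arguments degree_lt : simpl never.

Lemma degree_ltD d a b : degree_lt d a -> degree_lt d b -> degree_lt d (a + b).
Proof. by rewrite -[a in a + b]scale1r; apply: degree_lt_linear. Qed.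

Lemma degree_ltZ d c a : degree_lt d a -> degree_lt d (c *: a).
Proof.
by move=> ad; rewrite -[_ *: a]addr0; apply/degree_lt_linear/degree_lt0.
Qed.

Lemma degree_lt_sum (I : Type) (r : seq I) (P : pred I) (F : I -> A) d :
  (forall i, degree_lt d (F i)) -> degree_lt d (\sum_(i <- r | P i) F i).
Proof.
move=> Fd; elim/big_rec: _ => [|i a _ ad]; first exact: degree_lt0.
exact: degree_ltD.
Qed.

Lemma degree_lt_scalar d c : degree_lt d.+1 c%:A.
Proof.
exists c, (fun=> 0) => [t|]; first exact: degree_lt0.
by rewrite big1 ?addr0 // => t _; rewrite mulr0.
Qed.

Lemma degree_lt_gen d t a : degree_lt d a -> degree_lt d.+1 (g t * a).
Proof.
move=> ad; exists 0, (fun s => if s == t then a else 0) => [s|].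
  by case: eqP => // _; apply: degree_lt0.
rewrite scale0r add0r (bigD1 t) //= eqxx big1 ?addr0 // => s /negPf ->.
by rewrite mulr0.
Qed.

Lemma degree_ltS d a : degree_lt d a -> degree_lt d.+1 a.
Proof.
elim: d a => [|d IH] a; first by move=> ->; apply: degree_lt0.
move=> [c [b bd ->]]; apply: degree_ltD; first exact: degree_lt_scalar.
by apply: degree_lt_sum => t; apply/degree_lt_gen/IH/bd.
Qed.

Lemma degree_lt_leq d e a : (d <= e)%N -> degree_lt d a -> degree_lt e a.
Proof. by move/subnK <-; elim: (e - d)%N => // i IH /IH/degree_ltS. Qed.

(** By the Leibniz rule, [D s] either deletes the leading generator or passes to the shorter factor
    behind it. *)
Lemma degree_lt_comm s d a : degree_lt d.+1 a -> degree_lt d (D s a).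
Proof.
elim: d a => [|d IH] a [c [b bd ->]]; rewrite linearD /= comm_with_scalar add0r.
  by rewrite big1 ?linear0 // => t _; rewrite bd mulr0.
rewrite linear_sum; apply: degree_lt_sum => t /=; rewrite comm_with_leibniz ccr.
apply: degree_ltD; last by apply/degree_lt_gen/IH/bd.
by rewrite mulr_natl -scaler_nat; apply: degree_ltZ.
Qed.

Lemma iter_comm_degree_lt s d a : degree_lt d a -> iter d (D s) a = 0.
Proof. by elim: d a => // d IH a /(degree_lt_comm s)/IH; rewrite -iterSr. Qed.

(* Since [degree_lt d.+1] means degree at most [d], this says that the Euler
   operator multiplies by [d] up to terms of lower degree. *)
Lemma euler_degree_lt d a :
  degree_lt d.+1 a -> degree_lt d (\sum_t g t * D t a - a *+ d).
Proof.
pose E a := \sum_t g t * D t a.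
have EB x y : E (x + y) = E x + E y.
  by rewrite -big_split; apply: eq_bigr => t _ /=; rewrite linearD mulrDr.
have E0 : E 0 = 0 by rewrite /E big1 // => t _; rewrite linear0 mulr0.
have Ec c : E c%:A = 0.
  by rewrite /E big1 // => t _; rewrite comm_with_scalar mulr0.
rewrite -/(E a); elim: d a => [|d IH] a [c [b bd ->]].
  rewrite big1 ?addr0 => [|t _]; last by rewrite bd mulr0.
  by rewrite Ec mulr0n subrr.
rewrite EB Ec add0r mulrnDl opprD addrCA.
apply: degree_ltD.
  by rewrite -scaler_nat -scaleNr scalerA; apply: degree_lt_scalar.
rewrite (big_morph E EB E0) -sumrMnl -sumrB.
apply: degree_lt_sum => s.
(* [D s] hitting [g s] contributes one more copy of [g s * b s]. In the other terms [g t] is moved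
   past [g s], at the cost of a scalar commutator times [D t (b s)], which has lower degree. *)
suff -> : E (g s * b s) - g s * b s *+ d.+1 =
    g s * (E (b s) - b s *+ d) + \sum_t comm_with (g t) (g s) * D t (b s).
  apply: degree_ltD; first by apply/degree_lt_gen/IH/bd.
  apply: degree_lt_sum => t; have [c' ->] := gg_scalar t s.
  by rewrite mulr_algl; apply/degree_ltZ/degree_ltS/degree_lt_comm/bd.
rewrite mulrBr mulrnAr mulrS opprD addrA [in RHS]addrAC; congr (_ - _).
apply/eqP; rewrite subr_eq; apply/eqP; rewrite /E mulr_sumr -big_split /=.
transitivity (\sum_t (g t * g s * D t (b s)) + g s * b s).
  rewrite -[g s * b s in RHS]mulr1.
  under eq_bigr => t _ do rewrite comm_with_leibniz ccr mulrDr addrC mulrA.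
  rewrite big_split /= mulr1; congr (_ + _).
  rewrite (bigD1 s) //= eqxx mul1r big1 ?addr0 // => t /negPf ->.
  by rewrite mul0r mulr0.
congr (_ + _); apply: eq_bigr => t _.
by rewrite /comm_with mulrBl mulrA addrC subrK.
Qed.

Lemma mulrn_char0 (a : A) n : a *+ n.+1 = 0 -> a = 0.
Proof.
move/eqP; rewrite -scaler_nat scaler_eq0 => /orP[|/eqP //].
by have /pcharf0P -> := charK0.
Qed.

Hypothesis generated : forall a, exists d, degree_lt d a.

Lemma joint_kernel_scalar a : (forall t, D t a = 0) -> exists c : K, a = c%:A.
Proof.
move=> Da0; have [d] := generated a.
have E0 : \sum_t g t * D t a = 0 by rewrite big1 // => t _; rewrite Da0 mulr0.
(* Level 1 is a second base case: there the Euler eigenvalue is 0. From level 2 on it is [d.+1],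
   invertible in characteristic zero, so [a] drops one level. *)
elim: d => [->|[|d] IH ad]; first by exists 0; rewrite scale0r.
  have [c [b b0 ->]] := ad; exists c.
  by rewrite big1 ?addr0 // => t _; rewrite b0 mulr0.
apply: IH; have := degree_ltZ (- d.+1%:R^-1) (euler_degree_lt ad).
rewrite E0 sub0r scalerN scaleNr opprK -scaler_nat scalerA mulVf ?scale1r //.
by have /pcharf0P -> := charK0.
Qed.

Lemma ccr_mul_eq0 (a b : A) : a * b = 0 -> a = 0 \/ b = 0.
Proof.
(* The full enumeration imposes no condition on [u] and [v]; the empty list puts them in the joint
   kernel. *)
suff dom (s : seq T) u v :
    (forall t, t \notin s -> D t u = 0) -> (forall t, t \notin s -> D t v = 0) ->
    u * v = 0 -> u = 0 \/ v = 0.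
  by apply: (dom (enum T)) => t; rewrite mem_enum.
elim: s u v => [|t s IH] u v.
  move=> Du Dv; have [c ->] := joint_kernel_scalar (fun t => Du t isT).
  have [d ->] := joint_kernel_scalar (fun t => Dv t isT).
  rewrite mulr_algl => /eqP; rewrite !scaler_eq0 oner_eq0 !orbF.
  by case/orP => /eqP ->; rewrite scale0r; [left | right].
(* [P] is stable under [D t] because the derivations commute, and the kernel of [D t] on [P] is the
   case of [s]. *)
pose P x := forall r, r \notin t :: s -> D r x = 0.
apply: (@mul_eq0_of_kernel _ (D t) (comm_with_leibniz (h t)) P).
- exact: mulrn_char0.
- by move=> x; have [d /(iter_comm_degree_lt t)] := generated x; exists d.
- move=> x Px r /Px Drx; have [c /comm_with_comm ->] := hh_scalar r t.
  by rewrite Drx linear0.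
- move=> x y Px Py Dx Dy; apply: IH => r rs.
    by have [-> //|rt] := eqVneq r t; apply: Px; rewrite inE negb_or rt.
  by have [-> //|rt] := eqVneq r t; apply: Py; rewrite inE negb_or rt.
Qed.

End CanonicalCommutation.

(** * The Weyl algebra and its shift automorphisms *)

Section Weyl.
Variables (K : fieldType) (n : nat).
Local Notation weyl := (weyl K n).
Local Notation T := ('I_n + 'I_n)%type.
Local Notation X i := (weylX K i).
Local Notation Y i := (weylY K i).
Local Notation gen := (weyl_gens (B := weyl) (@weylX K n) (@weylY K n)).

Definition weyl_conj (t : T) : weyl :=
  match t with inl i => - Y i | inr i => X i end.

Lemma weyl_ccr (s t : T) : comm_with (weyl_conj s) (gen t) = (s == t)%:R.
Proof.
rewrite /comm_with; case: s t => i [] j /=.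
- have [_ _ xy] := weyl_relationsP K j i.
  by rewrite -[_ == _]/(i == j) eq_sym -xy mulNr mulrN opprK addrC.
- have [_ yy _] := weyl_relationsP K j i.
  by rewrite mulNr mulrN opprK addrC.
- by have [xx _ _] := weyl_relationsP K i j.
- by have [_ _ xy] := weyl_relationsP K i j.
Qed.

Lemma weyl_gen_scalar (s t : T) :
  exists c : K, comm_with (gen s) (gen t) = c%:A.
Proof.
rewrite /comm_with; case: s t => i [] j /=.
- by exists 0; have [-> _ _] := weyl_relationsP K i j; rewrite scale0r.
- exists (i == j)%:R; have [_ _ ->] := weyl_relationsP K i j.
  by rewrite scaler_nat.
- exists (- (j == i)%:R); have [_ _ xy] := weyl_relationsP K j i.
  by rewrite -opprB xy scaleNr scaler_nat.
- by exists 0; have [_ -> _] := weyl_relationsP K i j; rewrite scale0r.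
Qed.

Lemma weyl_conj_scalar (s t : T) :
  exists c : K, comm_with (weyl_conj s) (weyl_conj t) = c%:A.
Proof.
case: t => j /=.
  have [d eqd] := weyl_gen_scalar (inr j) (inr j).
  exists (- (s == inr j)%:R); rewrite linearN /= -[Y j]/(gen (inr j)) weyl_ccr.
  by rewrite scaleNr scaler_nat.
by exists (s == inl j)%:R; rewrite -[X j]/(gen (inl j)) weyl_ccr scaler_nat.
Qed.

Lemma weyl_generated a : exists d, degree_lt gen d a.
Proof.
elim/quotW: a => f; rewrite -/(weyl_proj f) [f]free_sumE linear_sum.
elim/big_ind: _ => [|a b [d ad] [e be]|m _]; first by exists 0.
  exists (maxn d e); apply: degree_ltD.
    by apply: degree_lt_leq ad; apply: leq_maxl.
  by apply: degree_lt_leq be; apply: leq_maxr.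
move: (mcoeff m f) => c; rewrite -(fmK m); elim: (m : seq T) => [|t s [d ad]].
  exists 1; have -> : << c *g FMonom [::] >> = c *: (1 : free_alg K T).
    by rewrite free_scaleE mulr1 -fmoneE.
  by rewrite linearZ rmorph1; apply: degree_lt_scalar.
exists d.+1; have -> : << c *g FMonom (t :: s) >> =
    free_gen K t * (<< c *g FMonom s >> : free_alg K T).
  by rewrite /free_gen free_mulUU mul1r /mmul /= fmmulE fmuE.
by rewrite rmorphM; have := degree_lt_gen t ad; case: t.
Qed.

(** Uniqueness in the universal property; it identifies composites of shifts by their values on
    generators. *)
Lemma weyl_endo_id (phi : {lrmorphism weyl -> weyl}) :
  (forall i, phi (X i) = X i) -> (forall i, phi (Y i) = Y i) -> phi =1 id.
Proof.
move=> phiX phiY a; have [d] := weyl_generated a.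
elim: d a => [|d IH] a; first by move=> ->; rewrite linear0.
move=> [c [b bd ->]] /=; rewrite linearD linearZ rmorph1 linear_sum.
congr (_ + _); apply: eq_bigr => t _ /=; rewrite rmorphM /= (IH _ (bd t)).
by case: t => i /=; rewrite ?phiX ?phiY.
Qed.

Lemma weyl_shift0 : weyl_shift (0 : 'rV[K]_n) =1 id.
Proof.
apply: weyl_endo_id => i; first exact: weyl_shiftX.
by rewrite weyl_shiftY mxE scale0r addr0.
Qed.

Lemma weyl_shiftK (k : 'rV[K]_n) : cancel (weyl_shift k) (weyl_shift (- k)).
Proof.
move: (weyl_shift k) (weyl_shift (- k)) (weyl_shiftX k) (weyl_shiftY k)
  (weyl_shiftX (- k)) (weyl_shiftY (- k)) => phi psi phiX phiY psiX psiY.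
apply: (@weyl_endo_id (psi \o phi)) => i /=; first by rewrite phiX psiX.
by rewrite phiY linearD linearZ rmorph1 /= psiY mxE scaleNr subrK.
Qed.

Hypothesis charK0 : [pchar K] =i pred0.

Lemma weyl_mul_eq0 (a b : weyl) : a * b = 0 -> a = 0 \/ b = 0.
Proof.
exact: (ccr_mul_eq0 charK0 weyl_ccr weyl_gen_scalar weyl_conj_scalar
  weyl_generated).
Qed.

Lemma weyl_shift_not_power_associative (k : 'rV[K]_n) l : k 0 l != 0 ->
  ~ power_associative (hom_weyl k).
Proof.
(* Cancelling the outer twist turns power-associativity at [a] into [[a, u * u] = 0], with [u] the
   shift of [a]. *)
move=> kl0 /(_ (X l * Y l))/(can_inj (weyl_shiftK k)) /=.
rewrite !(rmorphM (weyl_shift k)) /= weyl_shiftX weyl_shiftY.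
move/eqP; rewrite eq_sym -subr_eq0 => /eqP/(congr1 (comm_with (X l))).
have [_ _] := weyl_relationsP K l l; rewrite eqxx => xy.
rewrite linear0 (comm_with_square_shift _ xy) => /eqP.
rewrite scaler_eq0 oppr_eq0 (negPf kl0) /= => /eqP/(mulrn_char0 charK0).
(* A vanishing square would force [X l = 0], against [[X l, Y l] = 1]. *)
case/weyl_mul_eq0 => x0; move: xy; rewrite x0 mul0r mulr0 subrr;
  by move/esym/eqP; rewrite oner_eq0.
Qed.

End Weyl.

Theorem theorem1 (K : fieldType) (charK0 : [pchar K] =i pred0)
    (n : nat) (n_ge1 : (1 <= n)%N) (k : 'rV[K]_n) :
  [/\ field_embeds (hom_weyl k),
      unique (@weak_identity K (hom_weyl k)) (1 : weyl K n),
      forall a : hom_weyl k, ~ zero_divisor a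
    & power_associative (hom_weyl k) <-> k = 0].
Proof.
have shift_inj := can_inj (weyl_shiftK k).
have shift1 : weyl_shift k 1 = 1 by rewrite rmorph1.
split.
(* The shift fixes scalars, so on the line through 1 the twisted product is the ordinary one. *)
- pose emb (c : K^o) : weyl K n := (c : K) *: (1 : weyl K n).
  have emb_linear : linear emb by move=> c d d'; rewrite /emb scalerDl scalerA.
  pose f : {linear K^o -> weyl K n} :=
    HB.pack emb (GRing.isLinear.Build K K^o (weyl K n) *:%R emb emb_linear).
  exists f => [c d /eqP|c d]; rewrite /f /= /emb.
    by rewrite -subr_eq0 -scalerBl scaler_eq0 oner_eq0 orbF subr_eq0 => /eqP.
  by rewrite mulr_algl scalerA linearZ /= shift1.
(* Testing a weak identity on 1 shows that [e] and 1 have the same shift. *)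
- split=> [a|e /(_ (1 : weyl K n))[_]]; rewrite /hom_weyl /=.
    by rewrite mulr1 mul1r.
  by rewrite mulr1 => /shift_inj.
- move=> a [/eqP a0 [] [b /eqP b0]]; rewrite /hom_weyl /=;
    rewrite -[RHS](linear0 (weyl_shift k));
    by move/shift_inj/(weyl_mul_eq0 charK0) => [].
- split=> [pa|-> a]; last by rewrite /hom_weyl /= !weyl_shift0 mulrA.
  apply/eqP/contraT => /rV0Pn[l kl0].
  by case: (weyl_shift_not_power_associative charK0 kl0 pa).
Qed.
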